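(* Let $G$ be an SE-graph with $m$ sources and $n$ sinks and let $p_{ij}$ denote the $(i,j)$ entry of its path matrix $\mathrm{Path}_G$. Then for all $1\le i<\ell\le m$ and $1\le j<k\le n$: $$p_{ij}p_{ik}=q\,p_{ik}p_{ij},\quad p_{ij}p_{\ell j}=q\,p_{\ell j}p_{ij},\quad p_{ik}p_{\ell j}=p_{\ell j}p_{ik},\quad p_{ij}p_{\ell k}-p_{\ell k}p_{ij}=(q-q^{-1})\,p_{ik}p_{\ell j}.$$
   Context: Fix a field $\mathbb K$ and $q\in\mathbb K^\ast$. An SE-graph is a finite directed graph $G=(V,E)$ embedded in the plane (planar with a fixed layout) such that: every edge is either a horizontal edge (H-edge) directed to the right or a vertical edge (V-edge) directed downward; there are distinguished vertices $r_1,\dots,r_m$ (sources) lying on a vertical line in this order upward, and $c_1,\dots,c_n$ (sinks) lying on a horizontal line in this order from left to right; sources are incident only with H-edges and sinks only with V-edges; every vertex lies on a directed path from a source to a sink. Let $W$ be the set of inner vertices. $\mathcal L_G$ is the $\mathbb K$-algebra of Laurent polynomials in the elements of $W$ with relations, for distinct $u,v\in W$: $uv=qvu$ if $G$ has a directed horizontal path from $u$ to $v$; $vu=quv$ if $G$ has a directed vertical path from $u$ to $v$; $uv=vu$ otherwise. Edge weights: $w(e)=v$ if $e=(u,v)$ with $u$ a source; $w(e)=u^{-1}v$ if $e=(u,v)$ is an H-edge with $u,v\in W$; $w(e)=1$ for V-edges. The weight of a directed path is the ordered product of its edge weights. The path matrix $\mathrm{Path}_G$ is the $m\times n$ matrix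 over $\mathcal L_G$ whose $(i,j)$ entry is the sum of weights of all directed paths from $r_i$ to $c_j$ (zero if there are none). *)

(* Defs.v *)
From HB Require Import structures.
From mathcomp Require Import all_boot all_order all_algebra.
Set Implicit Arguments. Unset Strict Implicit. Unset Printing Implicit Defensive.
Import Order.TTheory GRing.Theory Num.Theory.
Local Open Scope ring_scope.

(* SE-graphs.  A finite simple directed graph on the finite vertex type V *)
(* (edge relation E), with a straight-line embedding in the plane R^2     *)
(* given by coordinates px, py : V -> R (R any ordered field, e.g. the    *)
(* reals).  Sources r : 'I_m -> V, sinks c : 'I_n -> V.                    *)

Section SE.
Variables (R : realFieldType) (V : finType).
Variables (px py : V -> R) (E : rel V) (m n : nat).
Variables (r : 'I_m -> V) (c : 'I_n -> V).

Definition is_source (v : V) : bool := [exists i, r i == v].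
Definition is_sink (v : V) : bool := [exists j, c j == v].
Definition is_inner (v : V) : bool := ~~ is_source v && ~~ is_sink v.

Definition Hedge (u v : V) : bool := E u v && (py u == py v) && (px u < px v).
Definition Vedge (u v : V) : bool := E u v && (px u == px v) && (py v < py u).

Definition on_seg (a b : V) (p1 p2 : R) : Prop :=
  exists t : R, 0 <= t <= 1 /\
    p1 = px a + t * (px b - px a) /\ p2 = py a + t * (py b - py a).

Definition planar_embedding : Prop :=
  [/\ (forall u v, px u = px v -> py u = py v -> u = v),
      (forall a b z, E a b -> on_seg a b (px z) (py z) -> z = a \/ z = b)
    & (forall a b a' b' p1 p2, E a b -> E a' b' -> (a, b) <> (a', b') ->
         on_seg a b p1 p2 -> on_seg a' b' p1 p2 ->
         ((p1, p2) = (px a, py a) \/ (p1, p2) = (px b, py b)) /\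
         ((p1, p2) = (px a', py a') \/ (p1, p2) = (px b', py b')))].

Definition SE_graph : Prop :=
  planar_embedding /\
      (forall u v, E u v -> Hedge u v || Vedge u v) /\
      (injective r /\ injective c /\ (forall i j, r i <> c j)) /\
      ((forall i i', px (r i) = px (r i')) /\
        (forall i i' : 'I_m, (i < i')%N -> py (r i) < py (r i'))) /\
      ((forall j j', py (c j) = py (c j')) /\
        (forall j j' : 'I_n, (j < j')%N -> px (c j) < px (c j'))) /\
      (forall u v, E u v -> [/\ ~~ is_source v, ~~ is_sink u,
          (is_source u -> Hedge u v) & (is_sink v -> Vedge u v)]) /\
      (forall v, exists i j, connect E (r i) v && connect E v (c j)).

Definition Hpath (u v : V) : bool := connect Hedge u v.
Definition Vpath (u v : V) : bool := connect Vedge u v.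

(* The algebra L_G.  x : V -> A assigns to each inner vertex w its        *)
(* generator x w (values at sources/sinks are irrelevant).  LG_rel says   *)
(* that the x w (w in W) are units of the K-algebra A satisfying the      *)
(* defining relations of L_G.                                             *)
Variables (K : fieldType) (A : unitAlgType K) (q : K) (x : V -> A).

Definition LG_rel : Prop :=
  (forall w, is_inner w -> x w \is a GRing.unit) /\
  (forall u v, is_inner u -> is_inner v -> u != v ->
     [/\ Hpath u v -> x u * x v = q *: (x v * x u),
         Vpath u v -> x v * x u = q *: (x u * x v)
       & ~~ Hpath u v -> ~~ Hpath v u -> ~~ Vpath u v -> ~~ Vpath v u ->
           x u * x v = x v * x u]).

Definition edge_weight (u v : V) : A :=
  if is_source u then x v
  else if Hedge u v then (x u)^-1 * x v
  else 1.

Definition path_weight (s0 : V) (s : seq V) : A :=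
  \prod_(e <- zip (s0 :: s) s) edge_weight e.1 e.2.

(* Path matrix: sum of the weights of all directed paths from r i to c j. *)
(* A directed path is given by its vertex sequence r i :: t; since the     *)
(* graph is acyclic every path has at most #|V| - 1 edges, so every path   *)
(* is counted exactly once below.                                          *)
Definition path_matrix : 'M[A]_(m, n) :=
  \matrix_(i < m, j < n)
    \sum_(k < #|V|.+1)
      \sum_(t : k.-tuple V | path E (r i) t && (last (r i) t == c j))
        path_weight (r i) t.

End SE.

(* Main.v *)
(** Sweep the plane by the line [px - py = T].  The edges met by the line form a
front, ordered along the line; to each of them and each source [r k] attach the
sum of the weights of the paths from [r k] that leave through that edge.
Crossing an inner vertex [v] replaces the neighbouring columns [H] (edge coming
from the left) and [W] (edge coming from above) by [D = H * x v + W] (edge going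
down) and [D * (x v)^-1] (edge going right), and planarity says that no other
front edge lies between them.  Every variable not yet swept skew-commutes with
each front column, so this replacement preserves the relations of quantum
matrices.  They hold trivially on the initial front, made of the edges leaving
the sources, and on the final one, made of the edges entering the sinks, they
are the claim.

A path leaving [r k] has the unpaired variable of its first turn on the row of
[r k]; this perturbs the relations at intermediate times by powers of [q], which
the coefficients [coef] record and which disappear at the sinks. *)

Require Import Defs.
From HB Require Import structures.
From mathcomp Require Import all_boot all_order all_algebra.
From mathcomp Require Import ring lra.
Set Implicit Arguments.
Unset Strict Implicit.
Unset Printing Implicit Defensive.
Import Order.TTheory GRing.Theory Num.Theory.
Local Open Scope ring_scope.

(** * Quantum matrix relations for two rows, under column operations *)

Section QuantumRelations.
Variables (K : fieldType) (A : unitAlgType K) (I : Type) (q : K) (i l : I).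
Hypothesis q_neq0 : q != 0.

Implicit Types (X Y F : I -> A) (c d s t : I -> K).

(* Relations between rows [i < l] of a quantum matrix: within a column [X], and
between a column [X] and a column [Y] to its right.  For [c = d = 1] they are
the relations of the theorem. *)
Definition qcol c X : Prop := c l *: (X i * X l) = (q * c i) *: (X l * X i).

Definition qpair c X d Y : Prop :=
  [/\ c i *: (X i * Y i) = (q * d i) *: (Y i * X i),
      d l *: (Y i * X l) = c i *: (X l * Y i)
    & c l *: (X i * Y l) - d i *: (Y l * X i)
        = ((q - q^-1) * d l) *: (Y i * X l)].

Lemma eq_qcol c c' X X' : c =1 c' -> X =1 X' -> qcol c X -> qcol c' X'.
Proof. by move=> ec eX; rewrite /qcol !ec !eX. Qed.

Lemma eq_qpair c c' X X' d d' Y Y' : c =1 c' -> X =1 X' -> d =1 d' -> Y =1 Y' ->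
  qpair c X d Y -> qpair c' X' d' Y'.
Proof. by move=> ec eX ed eY; rewrite /qpair !ec !eX !ed !eY. Qed.

Lemma qcol0 c X : (forall k, X k = 0) -> qcol c X.
Proof. by move=> X0; rewrite /qcol !X0 !(mul0r, scaler0). Qed.

Lemma qpair0l c X d Y : (forall k, X k = 0) -> qpair c X d Y.
Proof. by move=> X0; rewrite /qpair !X0 !(mul0r, mulr0, scaler0, subr0). Qed.

Lemma qpair0r c X d Y : (forall k, Y k = 0) -> qpair c X d Y.
Proof. by move=> Y0; rewrite /qpair !Y0 !(mul0r, mulr0, scaler0, subr0). Qed.

Lemma qpairDl c X X' d Y :
  qpair c X d Y -> qpair c X' d Y -> qpair c (fun k => X k + X' k) d Y.
Proof.
move=> [h1 h2 h3] [h1' h2' h3']; split.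
- by rewrite mulrDl mulrDr !scalerDr h1 h1'.
- by rewrite mulrDl mulrDr !scalerDr h2 h2'.
- set a := _ * d l in h3 h3' *.
  by rewrite mulrDl !mulrDr !scalerDr opprD addrACA h3 h3'.
Qed.

Lemma qpairDr c X d Y Y' :
  qpair c X d Y -> qpair c X d Y' -> qpair c X d (fun k => Y k + Y' k).
Proof.
move=> [h1 h2 h3] [h1' h2' h3']; split.
- by rewrite mulrDl mulrDr !scalerDr h1 h1'.
- by rewrite mulrDl mulrDr !scalerDr h2 h2'.
- set a := _ * d l in h3 h3' *.
  by rewrite !mulrDl !mulrDr !scalerDr opprD addrACA h3 h3'.
Qed.

(** In [qpair] every product carries the coefficient of its left column at the row of its right
    factor. Moving [y] past [Y k] costs [s k], which that coefficient absorbs. *)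
Lemma qpairMl c s X d Y (y : A) :
  (forall k, y * Y k = s k *: (Y k * y)) ->
  qpair (fun k => c k * s k) X d Y -> qpair c (fun k => X k * y) d Y.
Proof.
move=> yY [h1 h2 h3].
have mv a k k' : a *: (X k * y * Y k') = (a * s k') *: (X k * Y k') * y.
  by rewrite -mulrA yY -scalerAr scalerA mulrA scalerAl.
have mv' a k k' : a *: (Y k * (X k' * y)) = a *: (Y k * X k') * y.
  by rewrite mulrA scalerAl.
by split; rewrite !mv !mv' -?mulrBl ?h1 ?h2 ?h3.
Qed.

Lemma qpairMr c s X d Y (y : A) :
  (forall k, y * X k = s k *: (X k * y)) ->
  qpair c X (fun k => d k * s k) Y -> qpair c X d (fun k => Y k * y).
Proof.
move=> yX [h1 h2 h3].
have mv a k k' : a *: (Y k * y * X k') = (a * s k') *: (Y k * X k') * y.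
  by rewrite -mulrA yX -scalerAr scalerA mulrA scalerAl.
have mv' a k k' : a *: (X k * (Y k' * y)) = a *: (X k * Y k') * y.
  by rewrite mulrA scalerAl.
by split; rewrite !mv !mv' -?mulrBl -?mulrA ?h1 ?h2 ?h3.
Qed.

(** * Columns entering and leaving a vertex with variable [y] *)

Section Vertex.
Variables (y : A) (t : I -> K).
Hypotheses (y_unit : y \is a GRing.unit) (t_neq0 : forall k, t k != 0).

Lemma skew_inv (a : K) (z : A) :
  a != 0 -> y * z = a *: (z * y) -> y^-1 * z = a^-1 *: (z * y^-1).
Proof.
move=> a0 yz; apply: (mulrI y_unit); rewrite mulrA divrr // mul1r.
by rewrite -scalerAr mulrA yz -scalerAl scalerA mulVf // scale1r mulrK.
Qed.

Definition vert X Y : I -> A := fun k => X k * y + Y k.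

Lemma skew_vert X Y :
  (forall k, y * X k = (q / t k) *: (X k * y)) ->
  (forall k, y * Y k = (q / t k) *: (Y k * y)) ->
  forall k, y * vert X Y k = (q / t k) *: (vert X Y k * y).
Proof.
move=> yX yY k; rewrite /vert mulrDr mulrA yX yY mulrDl scalerDr.
by rewrite !scalerAl.
Qed.

Lemma qcol_vert X Y :
  (forall k, y * X k = (q / t k) *: (X k * y)) ->
  (forall k, y * Y k = (q / t k) *: (Y k * y)) ->
  qcol (fun k => (t k)^-1) X -> qcol (fun=> 1) Y ->
  qpair (fun k => (t k)^-1) X (fun=> 1) Y ->
  qcol (fun=> 1) (vert X Y).
Proof.
rewrite /qcol /qpair /vert => yX yY cX cY [_ h2 h3].
have eX k k' : X k * y * (X k' * y) = (q / t k') *: (X k * X k') * y ^+ 2.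
  by rewrite -mulrA [y * _]mulrA yX -!(scalerAl, scalerAr) !mulrA.
have eXY k k' : X k * y * Y k' = (q / t k') *: (X k * Y k') * y.
  by rewrite -mulrA yY -!(scalerAl, scalerAr) !mulrA.
(* Both sides are sorted by degree in [y]: degree 2 is settled by [cX], degree 0 by [cY], and degree
   1 is left for [h2] and [h3]. *)
rewrite scale1r mulr1 !mulrDr !mulrDl !eX !eXY !mulrA !scalerDr.
move: cY; rewrite scale1r mulr1 => ->.
have -> : (q / t l) *: (X i * X l) = q *: ((q / t i) *: (X l * X i)).
  by rewrite -scalerA cX.
rewrite -!scalerAl -!addrA; congr (_ + _); rewrite !addrA; congr (_ + _).
rewrite !scalerAl -!mulrDl; congr (_ * _).
move: h2 h3; rewrite scale1r mulr1 => h2.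
move/eqP; rewrite subr_eq scale1r => /eqP h3.
rewrite -!scalerAl -!scalerA h3 -h2 scalerDr addrA [RHS]addrC !scalerA.
rewrite -{1}[Y i * X l]scale1r -scalerDl.
(* The coefficients of [Y i * X l] agree because [1 + q * (q - q^-1) = q ^+ 2]. *)
by congr (_ *: _ + _); field.
Qed.

Section Out.
Variable D : I -> A.
Hypotheses (yD : forall k, y * D k = (q / t k) *: (D k * y))
           (cD : qcol (fun=> 1) D).

Let eD k k' : D k * y^-1 * D k' = (t k' / q) *: (D k * D k') * y^-1.
Proof.
have qt0 : q / t k' != 0 by rewrite mulf_neq0 ?invr_neq0.
by rewrite -mulrA (skew_inv qt0 (yD k')) -scalerAr scalerAl invf_div mulrA
           -scalerAl.
Qed.

Lemma qcol_out : qcol (fun k => (t k)^-1) (fun k => D k * y^-1).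
Proof.
rewrite /qcol !mulrA !eD -!mulrA -!scalerAl !scalerA.
move: cD; rewrite /qcol scale1r mulr1 => ->.
by rewrite -scalerAl scalerA; congr (_ *: _); field; rewrite q_neq0 !t_neq0.
Qed.

(** Scalars move [y^-1] to the far right and [cD] reorders the rows, so each relation compares
    multiples of a single product. *)
Lemma qpair_out :
  qpair (fun=> 1) D (fun k => (t k)^-1) (fun k => D k * y^-1).
Proof.
move: cD; rewrite /qcol /qpair scale1r mulr1 => eil.
rewrite !eD !mulrA -!scalerAl !scalerA eil -!scalerAl !scalerA -scalerBl.
by split; congr (_ *: _); field; rewrite q_neq0 ?t_neq0.
Qed.

End Out.
End Vertex.
End QuantumRelations.

(** * Auxiliary facts on connectivity and ordered fields *)

Lemma connect_first (T : finType) (e : rel T) (u z y : T) :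
  e u z -> (forall z', e u z' -> z' = z) -> y != u ->
  connect e u y = connect e z y.
Proof.
move=> euz uniq_z yu; apply/idP/idP => [/connectP[[|z' p] /= ]|].
- by move=> _ yE; rewrite yE eqxx in yu.
- by case/andP=> /uniq_z -> pp ->; apply/connectP; exists p.
- exact/connect_trans/connect1.
Qed.

Lemma connect_last (T : finType) (e : rel T) (u z y : T) :
  e z u -> (forall z', e z' u -> z' = z) -> y != u ->
  connect e y u = connect e y z.
Proof.
move=> ezu uniq_z yu.
have rev a b : connect e a b = connect [rel a' b' | e b' a'] b a.
  by rewrite connect_rev.
by rewrite !rev; apply: connect_first.
Qed.

Lemma connect_sub_rel (T : finType) (e e' : rel T) (u v : T) :
  subrel e e' -> connect e u v -> connect e' u v.
Proof. by move=> ee'; apply: connect_sub => a b /ee'/connect1. Qed.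

Lemma divr_in01 (R : realFieldType) (a b : R) :
  0 < b -> 0 <= a <= b -> 0 <= a / b <= 1.
Proof.
by move=> b0 /andP[a0 ab]; rewrite ler_pdivrMr // mul1r ab divr_ge0 // ltW.
Qed.

Section SEGraph.
Variables (R : realFieldType) (V : finType) (px py : V -> R) (E : rel V).
Variables (m n : nat) (r : 'I_m -> V) (c : 'I_n -> V).
Variables (K : fieldType) (q : K) (A : unitAlgType K) (x : V -> A).

Local Notation Hedge := (Hedge px py E).
Local Notation Vedge := (Vedge px py E).
Local Notation Hpath := (Hpath px py E).
Local Notation Vpath := (Vpath px py E).
Local Notation source := (is_source r).
Local Notation sink := (is_sink c).
Local Notation ew := (edge_weight px py E r x).
Local Notation pw := (path_weight px py E r x).

(** * Weighted sums over walks of fixed length *)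

Definition walk_sum (k : nat) (s u : V) : A :=
  \sum_(t : k.-tuple V | path E s t && (last s t == u)) pw s t.

Lemma walk_sum0 s u : walk_sum 0 s u = (s == u)%:R.
Proof.
rewrite /walk_sum big_mkcond /= (eq_bigr (fun=> (s == u)%:R)) => [|t _].
  by rewrite sumr_const card_tuple expn0.
by rewrite tuple0 /path_weight /= big_nil; case: eqP.
Qed.

Lemma walk_sumSl k s u :
  walk_sum k.+1 s u = \sum_(y | E s y) ew s y * walk_sum k y u.
Proof.
rewrite /walk_sum; under [RHS]eq_bigr do rewrite mulr_sumr.
rewrite pair_big_dep /=.
rewrite (reindex (fun yt : V * k.-tuple V => [tuple of yt.1 :: yt.2])) /=.
  apply: eq_big => [[y t]|[y t] _] /=; first by rewrite andbA.
  by rewrite /path_weight /= big_cons.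
exists (fun t => (thead t, [tuple of behead t])) => [[y t]|t] _ /=.
  by congr (_, _); apply: val_inj.
by rewrite [t in RHS]tuple_eta; apply: val_inj.
Qed.

(** The sweep extends paths at their ends, whereas [path_weight] unfolds from the start; induction
    on the length passes from one recursion to the other. *)
Lemma walk_sumSr k s u :
  walk_sum k.+1 s u = \sum_(y | E y u) walk_sum k s y * ew y u.
Proof.
elim: k s => [|k IHk] s; rewrite walk_sumSl.
  under eq_bigr do rewrite walk_sum0.
  under [RHS]eq_bigr do rewrite walk_sum0.
  rewrite big_mkcond [RHS]big_mkcond /= (bigD1 u) //= [RHS](bigD1 s) //=.
  rewrite !eqxx mulr1 mul1r !big1 // => y /negPf.
    by rewrite eq_sym => ->; rewrite mul0r if_same.
  by move=> ->; rewrite mulr0 if_same.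
under eq_bigr do rewrite IHk mulr_sumr.
under [RHS]eq_bigr do rewrite walk_sumSl mulr_suml.
by rewrite exchange_big /=; do 2![apply: eq_bigr => ? _]; rewrite mulrA.
Qed.

(** * Plane geometry of SE-graphs *)

Hypothesis HG : SE_graph px py E r c.

Definition sweep (u : V) : R := px u - py u.

Lemma HedgeP u v :
  reflect [/\ E u v, py u = py v & px u < px v] (Hedge u v).
Proof.
apply: (iffP andP) => [[/andP[? /eqP ?] ?]|[-> -> ->]]; first by split.
by rewrite eqxx.
Qed.

Lemma VedgeP u v :
  reflect [/\ E u v, px u = px v & py v < py u] (Vedge u v).
Proof.
apply: (iffP andP) => [[/andP[? /eqP ?] ?]|[-> -> ->]]; first by split.
by rewrite eqxx.
Qed.

Lemma edgeP u v : E u v -> Hedge u v \/ Vedge u v.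
Proof. by move=> Euv; apply/orP; case: HG => _ [+ _]; apply. Qed.

Lemma HV_edge u v : Hedge u v -> Vedge u v -> False.
Proof. by move=> /HedgeP[_ _ lt] /VedgeP[_ e _]; rewrite e ltxx in lt. Qed.

Lemma source_px i j : px (r i) = px (r j).
Proof. by case: HG => _ [_ [_ [[+ _] _]]]; apply. Qed.

Lemma source_py (i j : 'I_m) : (i < j)%N -> py (r i) < py (r j).
Proof. by case: HG => _ [_ [_ [[_ +] _]]]; apply. Qed.

Lemma sink_py i j : py (c i) = py (c j).
Proof. by case: HG => _ [_ [_ [_ [[+ _] _]]]]; apply. Qed.

Lemma sink_px (i j : 'I_n) : (i < j)%N -> px (c i) < px (c j).
Proof. by case: HG => _ [_ [_ [_ [[_ +] _]]]]; apply. Qed.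

Lemma edge_ends u v : E u v -> [/\ ~~ source v, ~~ sink u,
  source u -> Hedge u v & sink v -> Vedge u v].
Proof. by case: HG => _ [_ [_ [_ [_ [+ _]]]]]; apply. Qed.

Lemma reach v : exists i j, connect E (r i) v /\ connect E v (c j).
Proof.
case: HG => _ [_ [_ [_ [_ [_ /(_ v)]]]]] [i [j /andP[? ?]]].
by exists i, j.
Qed.

Lemma sourceP u : reflect (exists i, u = r i) (source u).
Proof. by apply: (iffP existsP) => -[i] => [/eqP <-|->]; exists i. Qed.

Lemma sinkP u : reflect (exists j, u = c j) (sink u).
Proof. by apply: (iffP existsP) => -[i] => [/eqP <-|->]; exists i. Qed.

Lemma source_r i : source (r i). Proof. by apply/sourceP; exists i. Qed.
Lemma sink_c j : sink (c j). Proof. by apply/sinkP; exists j. Qed.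

Lemma r_inj : injective r. Proof. by case: HG => _ [_ [[+ _] _]]. Qed.

Lemma sourceNsink u : source u -> ~~ sink u.
Proof.
case/sourceP=> i ->; apply/sinkP => -[j].
by case: HG => _ [_ [[_ [_ +]] _]]; apply.
Qed.

Lemma edge_mono u v : E u v -> px u <= px v /\ py v <= py u.
Proof.
by case/edgeP => [/HedgeP[_ -> /ltW]|/VedgeP[_ -> /ltW]].
Qed.

Lemma connect_mono u v : connect E u v -> px u <= px v /\ py v <= py u.
Proof.
case/connectP=> p; elim: p u => [|w p IHp] u /=; first by move=> _ ->.
by case/andP=> /edge_mono[? ?] pp /(IHp _ pp)[? ?]; split; lra.
Qed.

Lemma edge_sweep u v : E u v -> sweep u < sweep v.
Proof.
by rewrite /sweep; case/edgeP => [/HedgeP[_ -> ?]|/VedgeP[_ -> ?]]; lra.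
Qed.

Lemma connect_sweep u v : connect E u v -> sweep u <= sweep v.
Proof. by case/connect_mono; rewrite /sweep; lra. Qed.

(** A path from some source to [v] starts with an H-edge, which moves strictly right; later edges
    never move left, and the sources share one abscissa. *)
Lemma source_left v i : ~~ source v -> px (r i) < px v.
Proof.
have [i0 [_ [/connectP[p + vE] _]]] := reach v.
case: p vE => [|w p] /= vE; first by rewrite vE source_r.
case/andP=> Ew pp _; have [_ _ + _] := edge_ends Ew.
case/(_ (source_r _))/HedgeP=> _ _; rewrite (source_px i0 i) => lt.
suff [le _] : px w <= px v /\ py v <= py w by lra.
by apply: connect_mono; apply/connectP; exists p.
Qed.

Lemma sink_bottom v j : ~~ sink v -> py (c j) < py v.
Proof.
have [_ [j0 [_ /connectP[p + wE]]]] := reach v.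
case/lastP: p wE => [|p w]; first by move=> /= <-; rewrite sink_c.
rewrite last_rcons rcons_path => <- /andP[pp Ew] _.
have [_ _ _] := edge_ends Ew; case/(_ (sink_c _))/VedgeP=> _ _.
rewrite (sink_py j0 j) => lt.
suff [_ le] : px v <= px (last v p) /\ py (last v p) <= py v by lra.
by apply: connect_mono; apply/connectP; exists p.
Qed.

Lemma sink_bottom_le v j : py (c j) <= py v.
Proof.
have [_ [j0 [_ /connect_mono[_]]]] := reach v.
by rewrite (sink_py j0 j).
Qed.

Lemma H_between a b z : Hedge a b -> py z = py a -> px a <= px z <= px b ->
  z = a \/ z = b.
Proof.
case/HedgeP=> Eab yab xab yz /andP[az zb].
case: HG => -[_ + _] _; apply; first exact: Eab.
have ab0 : px b - px a != 0 by rewrite subr_eq0 gt_eqF.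
exists ((px z - px a) / (px b - px a)); split; last split.
- by apply: divr_in01; lra.
- by rewrite divfK //; ring.
- by rewrite yz yab subrr mulr0 addr0.
Qed.

Lemma V_between a b z : Vedge a b -> px z = px a -> py b <= py z <= py a ->
  z = a \/ z = b.
Proof.
case/VedgeP=> Eab xab yab xz /andP[bz za].
case: HG => -[_ + _] _; apply; first exact: Eab.
have ab0 : py a - py b != 0 by rewrite subr_eq0 gt_eqF.
exists ((py a - py z) / (py a - py b)); split; last split.
- by apply: divr_in01; lra.
- by rewrite xz xab subrr mulr0 addr0.
- by rewrite -[py b - _]opprB mulrN divfK //; ring.
Qed.

Lemma no_crossing a b a' b' : Hedge a b -> Vedge a' b' ->
  px a < px a' < px b -> py b' < py a < py a' -> False.
Proof.
move=> /HedgeP[Eab yab xab] /VedgeP[Eab' xab' yab'] /andP[x1 x2] /andP[y1 y2].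
case: HG => -[_ _ plan] _.
have ab0 : px b - px a != 0 by rewrite subr_eq0 gt_eqF.
have ab0' : py a' - py b' != 0 by rewrite subr_eq0 gt_eqF.
(* The edges would meet at [(px a', py a)], strictly inside the horizontal one, while planarity lets
   them meet only at end points. *)
have := plan a b a' b' (px a') (py a) Eab Eab'.
case.
- by case=> aE _; rewrite aE ltxx in x1.
- exists ((px a' - px a) / (px b - px a)); split; last split.
  + by apply: divr_in01; lra.
  + by rewrite divfK //; ring.
  + by rewrite yab subrr mulr0 addr0.
- exists ((py a' - py a) / (py a' - py b')); split; last split.
  + by apply: divr_in01; lra.
  + by rewrite xab' subrr mulr0 addr0.
  + by rewrite -[py b' - _]opprB mulrN divfK //; ring.
- by case=> -[] xE _; [move: x1|move: x2]; rewrite xE ltxx.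
Qed.

(** Of two H-edges leaving [u], the longer would pass through the head of the shorter. *)
Lemma Hedge_out_uniq u v v' : Hedge u v -> Hedge u v' -> v' = v.
Proof.
wlog le : v v' / px v <= px v' => [hw h h'|h h'].
  by case/orP: (le_total (px v) (px v')) => le; [|symmetry]; apply: hw le _ _.
have [_ yuv xuv] := HedgeP _ _ h.
case: (H_between h' (esym yuv)) => // [|vE]; first by rewrite ltW.
by rewrite vE ltxx in xuv.
Qed.

Lemma Hedge_in_uniq u v v' : Hedge v u -> Hedge v' u -> v' = v.
Proof.
wlog le : v v' / px v <= px v' => [hw h h'|h h'].
  by case/orP: (le_total (px v) (px v')) => le; [|symmetry]; apply: hw le _ _.
have [_ yuv xuv] := HedgeP _ _ h; have [_ yuv' xuv'] := HedgeP _ _ h'.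
case: (H_between h (z := v')) => // [||vE]; first by rewrite yuv' -yuv.
  by rewrite le ltW.
by rewrite vE ltxx in xuv'.
Qed.

Lemma Vedge_out_uniq u v v' : Vedge u v -> Vedge u v' -> v' = v.
Proof.
wlog le : v v' / py v' <= py v => [hw h h'|h h'].
  by case/orP: (le_total (py v') (py v)) => le; [|symmetry]; apply: hw le _ _.
have [_ xuv yuv] := VedgeP _ _ h.
case: (V_between h' (esym xuv)) => // [|vE]; first by rewrite le ltW.
by rewrite vE ltxx in yuv.
Qed.

Lemma Vedge_in_uniq u v v' : Vedge v u -> Vedge v' u -> v' = v.
Proof.
wlog le : v v' / py v' <= py v => [hw h h'|h h'].
  by case/orP: (le_total (py v') (py v)) => le; [|symmetry]; apply: hw le _ _.
have [_ xuv yuv] := VedgeP _ _ h; have [_ xuv' yuv'] := VedgeP _ _ h'.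
case: (V_between h (z := v')) => // [||vE]; first by rewrite xuv' -xuv.
  by rewrite le andbT ltW.
by rewrite vE ltxx in yuv'.
Qed.

(** [sweep] increases along a walk, so its vertices are distinct, and [#|V|] edges would need one
    vertex too many. *)
Lemma walk_sum_card s u : walk_sum #|V| s u = 0.
Proof.
rewrite /walk_sum big_pred0 // => t; apply/negbTE/negP => /andP[pt _].
suff /card_uniqP ct : uniq (s :: t).
  by have := max_card (mem (s :: t)); rewrite ct /= size_tuple ltnn.
apply: (@sorted_uniq _ (fun a b => sweep a < sweep b)).
- by move=> b a d; apply: lt_trans.
- by move=> a; apply: ltxx.
- by rewrite /=; apply: sub_path pt => a b /edge_sweep.
Qed.

Definition path_sum (i : 'I_m) (u : V) : A :=
  \sum_(k < #|V|.+1) walk_sum k (r i) u.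

Lemma path_sum_rec i u :
  path_sum i u = (r i == u)%:R + \sum_(y | E y u) path_sum i y * ew y u.
Proof.
rewrite /path_sum big_ord_recl walk_sum0; congr (_ + _).
(* On the right the term of length [#|V|] vanishes, so both sides range over the same lengths. *)
under [RHS]eq_bigr do rewrite big_ord_recr /= walk_sum_card addr0 mulr_suml.
rewrite exchange_big /=; apply: eq_bigr => k _.
by rewrite /bump /= add1n walk_sumSr.
Qed.

Lemma path_sum_source i k : path_sum i (r k) = (i == k)%:R.
Proof.
rewrite path_sum_rec (inj_eq r_inj) big_pred0 ?addr0 // => y.
by apply/negP => /edge_ends[]; rewrite source_r.
Qed.

(** * Skew-commutation of variables with path sums *)

Hypothesis q_neq0 : q != 0.
Hypothesis HL : LG_rel px py E r c q x.

Local Notation inner := (is_inner r c).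

Lemma x_unit v : inner v -> x v \is a GRing.unit.
Proof. by case: HL => + _; apply. Qed.

Lemma Hpath_py u v : Hpath u v -> py u = py v.
Proof.
case/connectP=> p; elim: p u => [|w p IHp] u /=; first by move=> _ ->.
by case/andP=> /HedgeP[_ -> _] pp /(IHp _ pp).
Qed.

Lemma Vpath_px u v : Vpath u v -> px u = px v.
Proof.
case/connectP=> p; elim: p u => [|w p IHp] u /=; first by move=> _ ->.
by case/andP=> /VedgeP[_ -> _] pp /(IHp _ pp).
Qed.

Lemma Hpath_connect u v : Hpath u v -> connect E u v.
Proof. by apply: connect_sub_rel => a b /HedgeP[]. Qed.

Lemma Vpath_connect u v : Vpath u v -> connect E u v.
Proof. by apply: connect_sub_rel => a b /VedgeP[]. Qed.

Lemma Hpath_Vpath u v : Hpath u v -> Vpath u v -> u = v.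
Proof.
move=> /Hpath_py ey /Vpath_px ex; case: HG => -[+ _ _] _; exact.
Qed.

(** The exponents are booleans, not both 1, since a horizontal and a vertical path with the same
    ends force [u = v]. *)
Lemma skew_x u v : inner u -> inner v -> ~~ connect E v u ->
  x v * x u = (q ^+ Vpath u v / q ^+ Hpath u v) *: (x u * x v).
Proof.
move=> iu iv nvu.
have uv : u != v by apply: contraNneq nvu => ->; rewrite connect0.
case: HL => _ /(_ u v iu iv uv) [hH hV h0].
case Huv: (Hpath u v); case Vuv: (Vpath u v) => /=.
- by move: uv; rewrite (Hpath_Vpath Huv Vuv) eqxx.
- by rewrite hH // scalerA expr0 expr1 mul1r mulVf // scale1r.
- by rewrite hV // expr0 expr1 divr1.
- rewrite expr0 divr1 scale1r h0 ?Huv ?Vuv //.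
  + by apply: contra nvu; apply: Hpath_connect.
  + by apply: contra nvu; apply: Vpath_connect.
Qed.

(* A strand [(u, true)] or [(u, false)] stands for the edge leaving [u] to the
right or downwards; by planarity there is at most one of each.  The downward
strand of a sink is the end of the paths.  The factor [(x u)^-1] is the part of
the weight of the next horizontal edge that depends on [u]. *)
Definition amp (i : 'I_m) (f : V * bool) : A :=
  path_sum i f.1 * (if f.2 && ~~ source f.1 then (x f.1)^-1 else 1).

(** By planarity the sum has at most one term; an absent edge gives the zero column, for which all
    relations are trivial. *)
Definition Hin i v := \sum_(u | Hedge u v) amp i (u, true).
Definition Vin i v := \sum_(u | Vedge u v) amp i (u, false).

Lemma Vedge_source u v : Vedge u v -> ~~ source u.
Proof.
move=> Vuv; have [Euv _ _] := VedgeP _ _ Vuv.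
apply/negP => su; have [_ _ /(_ su) Huv _] := edge_ends Euv.
exact: HV_edge Huv Vuv.
Qed.

Lemma Hedge_sink u v : Hedge u v -> ~~ sink v.
Proof.
move=> Huv; have [Euv _ _] := HedgeP _ _ Huv.
apply/negP => sv; have [_ _ _ /(_ sv)] := edge_ends Euv.
exact: HV_edge Huv.
Qed.

Lemma HinE i u v : Hedge u v -> Hin i v = amp i (u, true).
Proof.
move=> Huv; rewrite /Hin (big_pred1 u) // => w; apply/idP/eqP => [|-> //].
exact: Hedge_in_uniq.
Qed.

Lemma VinE i u v : Vedge u v -> Vin i v = amp i (u, false).
Proof.
move=> Vuv; rewrite /Vin (big_pred1 u) // => w; apply/idP/eqP => [|-> //].
exact: Vedge_in_uniq.
Qed.

Lemma HinP v : (exists u, Hedge u v) \/ (forall i, Hin i v = 0).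
Proof.
case: (pickP (Hedge^~ v)) => [u Huv|H0]; first by left; exists u.
by right => i; rewrite /Hin big_pred0.
Qed.

Lemma VinP v : (exists u, Vedge u v) \/ (forall i, Vin i v = 0).
Proof.
case: (pickP (Vedge^~ v)) => [u Vuv|V0]; first by left; exists u.
by right => i; rewrite /Vin big_pred0.
Qed.

(** The weight of an H-edge into [v] splits into the factor already in [amp] and [x v]; a V-edge has
    weight 1. *)
Lemma path_sumE i v : ~~ source v -> path_sum i v = Hin i v * x v + Vin i v.
Proof.
move=> sv; rewrite path_sum_rec.
have -> : (r i == v) = false by apply: contraNF sv => /eqP <-; apply: source_r.
rewrite add0r (bigID (Hedge^~ v)) /=; congr (_ + _); last first.
  apply: eq_big => [u|u /andP[Euv nH]].
    apply/andP/idP => [[/edgeP[->|] //]|Vuv].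
    split; first by case/VedgeP: Vuv.
    by apply/negP => Huv; apply: HV_edge Huv Vuv.
  have [h|Vuv] := edgeP Euv; first by rewrite h in nH.
  by rewrite /amp /edge_weight /= (negPf (Vedge_source Vuv)) (negPf nH).
rewrite mulr_suml; apply: eq_big => [u|u /andP[Euv Huv]].
  by apply/andP/idP => [[]|Huv] //; split=> //; case/HedgeP: Huv.
rewrite /amp /edge_weight /= Huv.
by case: (source u) => /=; rewrite ?mulr1 // mulrA.
Qed.

Definition straight (f : V * bool) v :=
  if f.2 then Hpath f.1 v else Vpath f.1 v.

Lemma Hpath_out u z v : Hedge u z -> v != u -> Hpath u v = Hpath z v.
Proof.
by move=> Huz; apply: connect_first => // z'; apply: Hedge_out_uniq.
Qed.

Lemma Vpath_out u z v : Vedge u z -> v != u -> Vpath u v = Vpath z v.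
Proof.
by move=> Vuz; apply: connect_first => // z'; apply: Vedge_out_uniq.
Qed.

Lemma skew_invr (a : K) (y z : A) : y \is a GRing.unit -> a != 0 ->
  z * y = a *: (y * z) -> z * y^-1 = a^-1 *: (y^-1 * z).
Proof.
move=> uy a0 zy; apply: (mulIr uy); rewrite mulrVK // -scalerAl -mulrA zy.
by rewrite -scalerAr scalerA mulVf // scale1r mulKr.
Qed.

Lemma q_exp_neq0 k : q ^+ k != 0.
Proof. by rewrite expf_neq0. Qed.

(** Entering [u] from the left appends [x u], which trades the exponent [Hpath u v] for [Vpath u v];
    leaving to the right appends its inverse and trades back. The exponents telescope: only the
    current direction and the row of the source remain. *)
Lemma skew_amp i f v : inner v -> ~~ connect E v f.1 ->
  (if f.2 then ~~ sink f.1 else ~~ source f.1) ->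
  x v * amp i f = (q ^+ straight f v / q ^+ Hpath (r i) v) *: (amp i f * x v).
Proof.
move=> iv.
(* Predecessors of [f.1] have smaller [sweep], so this number decreases. *)
have [N] := ubnP #|[set w | sweep w < sweep f.1]|.
elim: N f => // N IHN [u b] /= leN nvu.
have IH u' b' : E u' u -> (if b' then ~~ sink u' else ~~ source u') ->
    x v * amp i (u', b') = (q ^+ straight (u', b') v / q ^+ Hpath (r i) v)
      *: (amp i (u', b') * x v).
  move=> Eu'u ok; apply: IHN => //=; last first.
    by apply: contra nvu => /connect_trans; apply; apply: connect1.
  have lt := edge_sweep Eu'u.
  rewrite ltnS in leN; apply: leq_trans leN.
  apply: proper_card; apply/properP; split.
    by apply/subsetP => w; rewrite !inE => /lt_trans; apply.
  by exists u'; rewrite !inE ?ltxx.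
have [su|su] := boolP (source u).
  (* At a source only its own row is nonzero, and there the two exponents cancel. *)
  case: b => // _; rewrite /amp /straight /= su /= mulr1.
  have [k uE] := sourceP _ su; rewrite uE path_sum_source.
  case: eqP => [<-|_]; last by rewrite mulr0 mul0r scaler0.
  by rewrite mulr1 mul1r divff ?q_exp_neq0 // scale1r.
have neq_in u' : E u' u -> v != u'.
  by move=> Eu'u; apply: contraNneq nvu => ->; apply: connect1.
have main : x v * path_sum i u =
    (q ^+ Vpath u v / q ^+ Hpath (r i) v) *: (path_sum i u * x v).
  rewrite path_sumE // mulrDr mulrDl scalerDr; congr (_ + _).
    have [[u' Hu]|->] := HinP u; last by rewrite !(mul0r, mulr0) scaler0.
    have [Eu _ _] := HedgeP _ _ Hu; have [_ nsk _ _] := edge_ends Eu.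
    have iu : inner u by rewrite /is_inner su (Hedge_sink Hu).
    rewrite (HinE _ Hu) mulrA (IH _ true) // -scalerAl -(mulrA _ (x v)).
    rewrite (skew_x iu) //.
    rewrite -scalerAr scalerA; congr (_ *: _); last by rewrite !mulrA.
    rewrite /straight /= (Hpath_out Hu) ?neq_in //.
    by field; rewrite !q_exp_neq0.
  have [[u' Vu]|->] := VinP u; last by rewrite !(mul0r, mulr0) scaler0.
  have [Eu _ _] := VedgeP _ _ Vu.
  rewrite (VinE _ Vu) (IH _ false) ?(Vedge_source Vu) // /straight /=.
  by rewrite (Vpath_out Vu) ?neq_in.
case: b => sk; rewrite /amp /straight /= ?mulr1 // su.
have iu : inner u by rewrite /is_inner su sk.
have q0 := q_exp_neq0.
rewrite mulrA main -scalerAl -(mulrA _ (x v)).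
rewrite (skew_invr (x_unit iu) _ (skew_x iu iv nvu)) ?mulf_neq0 ?invr_neq0 //.
rewrite -scalerAr scalerA; congr (_ *: _); last by rewrite !mulrA.
by field; rewrite !q0.
Qed.

(** * Fronts and the order of their strands *)

Definition front (D : {set V}) (f : V * bool) : bool :=
  (f.1 \in D) &&
  (if f.2 then [exists z, Hedge f.1 z && (z \notin D)]
   else sink f.1 || [exists z, Vedge f.1 z && (z \notin D)]).

(* Order of two strands along any sweep line that meets both. Two strands of
different kinds do not cross, so their order is read off their tails. *)
Definition before (f g : V * bool) : bool :=
  match f.2, g.2 with
  | true, true => py f.1 < py g.1
  | false, false => px f.1 < px g.1
  | true, false => (px f.1 < px g.1) && (py f.1 < py g.1)
  | false, true => (px f.1 <= px g.1) || (py f.1 <= py g.1)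
  end.

Definition into (f : V * bool) v := if f.2 then Hedge f.1 v else Vedge f.1 v.

Definition coef (f : V * bool) (k : 'I_m) : K :=
  if f.2 then (q ^+ Hpath (r k) f.1)^-1 else 1.

Definition front_rel i l D : Prop :=
  (forall f, front D f -> qcol q i l (coef f) (amp^~ f)) /\
  (forall f g, front D f -> front D g -> before f g ->
     qpair q i l (coef f) (amp^~ f) (coef g) (amp^~ g)).

(* [v] is swept right after the vertices of [D]; vertices with equal [sweep] may
be taken in any order. *)
Section Step.
Variables (D : {set V}) (v : V).
Hypotheses (vD : v \notin D) (sv : ~~ source v)
  (pastD : forall u, u \in D -> ~~ source u -> sweep u <= sweep v)
  (futureD : forall z, z \notin D -> sweep v <= sweep z).

(** The sweep line rises to the right, so height and abscissa order its points alike; a strand is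
    compared by the coordinate that is constant along it. *)
Definition leftof (f : V * bool) :=
  if f.2 then py f.1 < py v else px f.1 < px v.
Definition rightof (f : V * bool) :=
  if f.2 then py v < py f.1 else px v < px f.1.

(** * Planarity around the swept vertex *)

Lemma past_H u : u \in D -> py u <= py v -> px u <= px v.
Proof.
move=> uD uv; have [/sourceP[k ->]|su] := boolP (source u).
  exact/ltW/source_left.
by have := pastD uD su; rewrite /sweep; lra.
Qed.

Lemma past_H_lt u : u \in D -> py u < py v -> px u < px v.
Proof.
move=> uD uv; have [/sourceP[k ->]|su] := boolP (source u).
  exact/source_left.
by have := pastD uD su; rewrite /sweep; lra.
Qed.

Lemma front_V u : front D (u, false) -> u \in D /\ ~~ source u.
Proof.
case/andP=> /= uD ok; split=> //; case/orP: ok => [|/existsP[z /andP[Vuz _]]].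
  by apply: contraL => /sourceNsink.
exact: Vedge_source Vuz.
Qed.

(** At the height of [v], the tail of the strand is not to the right of [v] and its head not to the
    left, so the edge would contain [v]; it could then only end there. *)
Lemma front_row u : front D (u, true) -> ~~ Hedge u v -> py u != py v.
Proof.
case/andP=> /= uD /existsP[z /andP[Huz zD]]; apply: contra => /eqP uv.
have [_ yz xz] := HedgeP _ _ Huz.
have le : px u <= px v by apply: past_H => //; rewrite uv.
case: (H_between Huz (esym uv)) => [|vE|-> //].
  by have := futureD zD; rewrite /sweep; lra.
by move: vD; rewrite vE uD.
Qed.

Lemma front_col u : front D (u, false) -> ~~ Vedge u v -> px u != px v.
Proof.
move=> fu; have [uD su] := front_V fu; case/andP: fu => /= _.
have := pastD uD su; rewrite /sweep => le.
have uv_neq : u != v by apply: contraNneq vD => <-.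
case/orP=> [sku _|/existsP[z /andP[Vuz zD]]].
  (* Another sink has a different abscissa, and a non-sink straight above [u] would have smaller
     [sweep] than [u]. *)
  have [j uE] := sinkP _ sku; have [skv|skv] := boolP (sink v).
    have [k vE] := sinkP _ skv; rewrite uE vE.
    case: (ltngtP j k) => [/sink_px/lt_eqF -> //|/sink_px/gt_eqF -> //|jk].
    by move: uv_neq; rewrite uE vE (val_inj jk) eqxx.
  have := sink_bottom j skv; rewrite -uE => lt.
  by apply/eqP => e; lra.
apply: contra => /eqP uv; have [_ xz yz] := VedgeP _ _ Vuz.
case: (V_between Vuz (esym uv)) => [|vE|-> //].
  by have := futureD zD; rewrite /sweep; lra.
by rewrite vE eqxx in uv_neq.
Qed.

Lemma before_left f b :
  front D f -> ~~ into f v -> before f (v, b) -> leftof f.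
Proof.
case: f => u [] ff nv; rewrite /before /leftof /=.
  by case: b => // /andP[].
case: b => //; have := front_col ff nv; have [uD su] := front_V ff.
have := pastD uD su; rewrite /sweep lt_neqAle => le -> /=.
by case/orP => // ?; lra.
Qed.

Lemma before_right f b :
  front D f -> ~~ into f v -> before (v, b) f -> rightof f.
Proof.
case: f => u [] ff nv; rewrite /before /rightof /=; last first.
  by case: b => // /andP[].
have uD : u \in D by case/andP: ff.
case: b => //; have := front_row ff nv; rewrite lt_neqAle eq_sym => -> /=.
case/orP => // xv; rewrite leNgt; apply/negP => /(past_H_lt uD).
by rewrite ltNge xv.
Qed.

(** Together with [before_left]: an old strand preceding one out of [v] also precedes those into
    [v], so its relations with the incoming columns are known. *)
Lemma left_before f g :
  front D f -> ~~ into f v -> leftof f -> into g v -> before f g.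
Proof.
case: f g => u [] [w []]; rewrite /before /leftof /into /= => ff nv lt.
- by case/HedgeP=> _ ->.
- case/VedgeP=> _ -> wv; have uD : u \in D by case/andP: ff.
  by rewrite (past_H_lt uD) //=; apply: lt_trans wv.
- move=> Hwv; have [_ yw xw] := HedgeP _ _ Hwv.
  (* Otherwise the vertical edge leaving [u], whose head is not yet swept, would cross the
     horizontal edge into [v]. *)
  rewrite -implyNb -ltNge; apply/implyP => wu; rewrite leNgt; apply/negP => yu.
  have [uD su] := front_V ff; case/andP: ff => /= _.
  case/orP => [/sinkP[j uE]|/existsP[z /andP[Vuz zD]]].
    by have := sink_bottom_le v j; rewrite -uE; lra.
  have [_ xz yz] := VedgeP _ _ Vuz.
  apply: (no_crossing Hwv Vuz); first by rewrite wu.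
  by have := futureD zD; rewrite /sweep; lra.
- by case/VedgeP=> _ ->.
Qed.

Lemma right_before f g :
  front D f -> ~~ into f v -> rightof f -> into g v -> before g f.
Proof.
case: f g => u [] [w []]; rewrite /before /rightof /into /= => ff nv lt.
- by case/HedgeP=> _ ->.
- move=> Vwv; have [_ xw yw] := VedgeP _ _ Vwv.
  rewrite -implyNb -ltNge; apply/implyP => uw; rewrite leNgt; apply/negP => yu.
  case/andP: ff => /= uD /existsP[z /andP[Huz zD]].
  have [_ yz xz] := HedgeP _ _ Huz.
  apply: (no_crossing Huz Vwv); last by rewrite lt.
  by have := futureD zD; rewrite /sweep; lra.
- case/HedgeP=> _ -> wv; have [uD su] := front_V ff.
  by have := pastD uD su; rewrite /sweep; lra.
- by case/VedgeP=> _ ->.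
Qed.

Lemma front_next f : front (v |: D) f -> ~~ (front D f && ~~ into f v) ->
  f.1 = v.
Proof.
case: f => u b /andP[] /=; rewrite !inE => /orP[/eqP //|uD] ok.
case/negP; rewrite /front /into /= uD /=.
case: b ok => [|/orP[sku|]].
- case/existsP=> z /andP[Huz]; rewrite !inE negb_or => /andP[zv zD].
  apply/andP; split; first by apply/existsP; exists z; rewrite Huz.
  by apply: contra zv => /(Hedge_out_uniq Huz) ->.
- rewrite sku /=; apply/negP => /VedgeP[/edge_ends[]].
  by rewrite sku.
- case/existsP=> z /andP[Vuz]; rewrite !inE negb_or => /andP[zv zD].
  apply/andP; split.
    by apply/orP; right; apply/existsP; exists z; rewrite Vuz.
  by apply: contra zv => /(Vedge_out_uniq Vuz) ->.
Qed.

(** The next vertex [z] on the strand is unswept, so its [sweep] is at least that of [v] and [v]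
    cannot lie beyond it; a sink has no next vertex. *)
Lemma straight_front f : front D f -> ~~ into f v -> straight f v = false.
Proof.
have vu u : u \in D -> v != u by move=> uD; apply: contraNneq vD => ->.
case: f => u [] ff; rewrite /into /straight /= => nv.
  case/andP: ff => /= uD /existsP[z /andP[Huz zD]].
  rewrite (Hpath_out Huz) ?vu //; apply/negP => Hzv.
  have /Hpath_py ey := Hzv; have /Hpath_connect/connect_mono[ex _] := Hzv.
  have exz : px z = px v by have := futureD zD; rewrite /sweep; lra.
  have zv : z = v by case: HG => -[+ _ _] _; apply.
  by rewrite -zv Huz in nv.
case/andP: ff => /= uD /orP[sku|/existsP[z /andP[Vuz zD]]].
  apply/negP => /connectP[[|z p] /=].
    by move=> _ vE; have := vu u uD; rewrite vE eqxx.
  by case/andP=> /VedgeP[/edge_ends[_]]; rewrite sku.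
rewrite (Vpath_out Vuz) ?vu //; apply/negP => Vzv.
have /Vpath_px ex := Vzv; have /Vpath_connect/connect_mono[_ ey] := Vzv.
have eyz : py z = py v by have := futureD zD; rewrite /sweep; lra.
have zv : z = v by case: HG => -[+ _ _] _; apply.
by rewrite -zv Vuz in nv.
Qed.

Lemma not_reach_front u : u \in D -> ~~ connect E v u.
Proof.
move=> uD; apply/negP => vu; have [su|su] := boolP (source u).
  have [k uE] := sourceP _ su; have := source_left k sv.
  by have [+ _] := connect_mono vu; rewrite uE; lra.
have := pastD uD su; case/connectP: vu => [[|w p]] /=.
  by move=> _ uE; move: vD; rewrite -uE uD.
case/andP=> /edge_sweep lt pp uE.
have /connect_sweep : connect E w u by apply/connectP; exists p.
by lra.
Qed.

Lemma into_front g : into g v -> front D g.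
Proof.
have inD u : E u v -> u \in D.
  move=> /edge_sweep lt; apply/negPn/negP => /futureD.
  by rewrite leNgt lt.
case: g => u []; rewrite /into /front /=.
  move=> Huv; rewrite inD; last by case/HedgeP: Huv.
  by apply/existsP; exists v; rewrite Huv.
move=> Vuv; rewrite inD; last by case/VedgeP: Vuv.
by apply/orP; right; apply/existsP; exists v; rewrite Vuv.
Qed.

(** * Columns entering the swept vertex *)

Let t (k : 'I_m) : K := q ^+ Hpath (r k) v.

(** The only H-edge into [v] comes from [u] and [v] is not a source, so [v] lies on the row of [r k]
    exactly when [u] does. *)
Lemma coef_in u : Hedge u v -> coef (u, true) =1 (fun k => (t k)^-1).
Proof.
move=> Huv k; rewrite /coef /t /=; congr (_ ^+ _)^-1; congr nat_of_bool.
apply/esym/connect_last => // [z'|]; first exact: Hedge_in_uniq.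
by apply: contraNneq sv => <-; apply: source_r.
Qed.

Variables i l : 'I_m.
Hypothesis relD : front_rel i l D.

Let Hcol (k : 'I_m) := Hin k v.
Let Vcol (k : 'I_m) := Vin k v.

Lemma qcol_Hin : qcol q i l (fun k => (t k)^-1) Hcol.
Proof.
have [[u Hu]|H0] := HinP v; last exact: qcol0.
apply: (eq_qcol (coef_in Hu)) => [k|]; first by rewrite /Hcol (HinE _ Hu).
by apply: relD.1; apply: into_front.
Qed.

Lemma qcol_Vin : qcol q i l (fun=> 1) Vcol.
Proof.
have [[u Vu]|V0] := VinP v; last exact: qcol0.
apply: (@eq_qcol _ _ _ _ _ _ (coef (u, false)) _ (amp^~ (u, false))) => //.
  by move=> k; rewrite /Vcol (VinE _ Vu).
by apply: relD.1; apply: into_front.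
Qed.

Lemma qpair_HVin : qpair q i l (fun k => (t k)^-1) Hcol (fun=> 1) Vcol.
Proof.
have [[u Hu]|H0] := HinP v; last exact: qpair0l.
have [[w Vw]|V0] := VinP v; last exact: qpair0r.
apply: (@eq_qpair _ _ _ _ _ _ (coef (u, true)) _ (amp^~ (u, true)) _
  (coef (w, false)) _ (amp^~ (w, false))) => //.
- exact: coef_in.
- by move=> k; rewrite /Hcol (HinE _ Hu).
- by move=> k; rewrite /Vcol (VinE _ Vw).
apply: relD.2; rewrite ?into_front //.
have [_ yu xu] := HedgeP _ _ Hu; have [_ xw yw] := VedgeP _ _ Vw.
by rewrite /before /= xw yu xu.
Qed.

Lemma qpair_Hin_front f : front D f -> ~~ into f v ->
  (leftof f -> qpair q i l (coef f) (amp^~ f) (fun k => (t k)^-1) Hcol) /\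
  (rightof f -> qpair q i l (fun k => (t k)^-1) Hcol (coef f) (amp^~ f)).
Proof.
move=> ff nf; have [[u Hu]|H0] := HinP v; last first.
  by split=> _; [apply: qpair0r|apply: qpair0l].
have eH : amp^~ (u, true) =1 Hcol by move=> k; rewrite /Hcol (HinE _ Hu).
split=> side.
  apply: (eq_qpair (frefl _) (frefl _) (coef_in Hu) eH).
  by apply: relD.2 => //; [apply: into_front|apply: left_before].
apply: (eq_qpair (coef_in Hu) eH (frefl _) (frefl _)).
by apply: relD.2 => //; [apply: into_front|apply: right_before].
Qed.

Lemma qpair_Vin_front f : front D f -> ~~ into f v ->
  (leftof f -> qpair q i l (coef f) (amp^~ f) (fun=> 1) Vcol) /\
  (rightof f -> qpair q i l (fun=> 1) Vcol (coef f) (amp^~ f)).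
Proof.
move=> ff nf; have [[u Vu]|V0] := VinP v; last first.
  by split=> _; [apply: qpair0r|apply: qpair0l].
have eV : amp^~ (u, false) =1 Vcol by move=> k; rewrite /Vcol (VinE _ Vu).
have eC : coef (u, false) =1 (fun=> 1) by [].
split=> side.
  apply: (eq_qpair (frefl _) (frefl _) eC eV).
  by apply: relD.2 => //; [apply: into_front|apply: left_before].
apply: (eq_qpair eC eV (frefl _) (frefl _)).
by apply: relD.2 => //; [apply: into_front|apply: right_before].
Qed.

Let t_neq0 k : t k != 0. Proof. exact: q_exp_neq0. Qed.

Lemma into_skew g k : inner v -> into g v ->
  x v * amp k g = (q / t k) *: (amp k g * x v).
Proof.
move=> iv gv; have /andP[gD _] := into_front gv.
rewrite (skew_amp k iv (not_reach_front gD)); last first.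
  case: g gv {gD} => u []; rewrite /into /=; last exact: Vedge_source.
  by case/HedgeP => /edge_ends[].
have -> : straight g v = true; last by [].
case: g gv {gD} => u []; rewrite /into /straight /=; exact: connect1.
Qed.

Lemma skew_Hin k : inner v -> x v * Hcol k = (q / t k) *: (Hcol k * x v).
Proof.
move=> iv; rewrite /Hcol; have [[u Hu]|->] := HinP v.
  by rewrite (HinE _ Hu) into_skew.
by rewrite mulr0 mul0r scaler0.
Qed.

Lemma skew_Vin k : inner v -> x v * Vcol k = (q / t k) *: (Vcol k * x v).
Proof.
move=> iv; rewrite /Vcol; have [[u Vu]|->] := VinP v.
  by rewrite (VinE _ Vu) into_skew.
by rewrite mulr0 mul0r scaler0.
Qed.

Lemma skew_front f k : inner v -> front D f -> ~~ into f v ->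
  x v * amp k f = (t k)^-1 *: (amp k f * x v).
Proof.
move=> iv ff nf; have /andP[fD ok] := ff.
rewrite (skew_amp k iv (not_reach_front fD)) ?straight_front ?expr0 ?mul1r //.
case: f ff fD ok {nf} => u [] ff fD /=; last by case: (front_V ff).
by case/existsP=> z /andP[/HedgeP[/edge_ends[]]].
Qed.

(** * Columns leaving the swept vertex *)

Let Dcol (k : 'I_m) := path_sum k v.

Lemma DcolE : Dcol =1 vert (x v) Hcol Vcol.
Proof. by move=> k; rewrite /Dcol path_sumE. Qed.

(** At a sink [x v] is arbitrary; no H-edge enters a sink, so it only multiplies zeros. *)
Lemma Hin_sink : sink v -> forall k, Hcol k = 0.
Proof.
by move=> skv; have [[u /Hedge_sink]|//] := HinP v; rewrite skv.
Qed.

Lemma innerV : ~~ sink v -> inner v.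
Proof. by rewrite /is_inner sv. Qed.

Lemma qcol_D : qcol q i l (fun=> 1) Dcol.
Proof.
have [skv|/innerV iv] := boolP (sink v).
  apply: eq_qcol qcol_Vin => // k.
  by rewrite DcolE /vert Hin_sink // mul0r add0r.
apply: (eq_qcol (frefl _) (fsym DcolE)).
apply: (@qcol_vert _ _ _ _ _ _ q_neq0 _ t) => // [k|k|||].
- exact: skew_Hin.
- exact: skew_Vin.
- exact: qcol_Hin.
- exact: qcol_Vin.
- exact: qpair_HVin.
Qed.

(** Moving [x v] past the column of [f] yields [(t k)^-1], which turns the coefficient 1 of [Dcol]
    into that of [Hcol]. *)
Lemma qpair_D_front f : front D f -> ~~ into f v ->
  (leftof f -> qpair q i l (coef f) (amp^~ f) (fun=> 1) Dcol) /\
  (rightof f -> qpair q i l (fun=> 1) Dcol (coef f) (amp^~ f)).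
Proof.
move=> ff nf; have [lV rV] := qpair_Vin_front ff nf.
have [lH rH] := qpair_Hin_front ff nf.
split=> side.
  apply: (eq_qpair (frefl _) (frefl _) (frefl _) (fsym DcolE)).
  apply: qpairDr (lV side); have [skv|/innerV iv] := boolP (sink v).
    by apply: qpair0r => k; rewrite Hin_sink // mul0r.
  apply: (qpairMr (s := fun k => (t k)^-1)) => [k|]; first exact: skew_front.
  by apply: eq_qpair (lH side) => // k; rewrite mul1r.
apply: (eq_qpair (frefl _) (fsym DcolE) (frefl _) (frefl _)).
apply: qpairDl (rV side); have [skv|/innerV iv] := boolP (sink v).
  by apply: qpair0l => k; rewrite Hin_sink // mul0r.
apply: (qpairMl (s := fun k => (t k)^-1)) => [k|]; first exact: skew_front.
by apply: eq_qpair (rH side) => // k; rewrite mul1r.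
Qed.

Lemma amp_out (b : bool) k :
  amp k (v, b) = if b then Dcol k * (x v)^-1 else Dcol k.
Proof. by rewrite /amp /= sv; case: b => //=; rewrite mulr1. Qed.

Lemma skew_D k : inner v -> x v * Dcol k = (q / t k) *: (Dcol k * x v).
Proof.
move=> iv; rewrite DcolE; apply: skew_vert => k'.
  exact: skew_Hin.
exact: skew_Vin.
Qed.

Lemma qcol_new (b : bool) :
  (b -> inner v) -> qcol q i l (coef (v, b)) (amp^~ (v, b)).
Proof.
case: b => [/(_ isT) iv|_]; last first.
  by apply: eq_qcol qcol_D => // k; rewrite amp_out.
apply: eq_qcol (qcol_out q_neq0 (x_unit iv) t_neq0 _ qcol_D) => // k.
- by rewrite amp_out.
- exact: skew_D.
Qed.

(** The factor [t k] from moving the inverse of [x v] past [f] cancels the coefficient [(t k)^-1] of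
    the right strand and leaves the relation for [Dcol]. *)
Lemma qpair_new_front f (b : bool) :
  (b -> inner v) -> front D f -> ~~ into f v ->
  (leftof f ->
     qpair q i l (coef f) (amp^~ f) (coef (v, b)) (amp^~ (v, b))) /\
  (rightof f ->
     qpair q i l (coef (v, b)) (amp^~ (v, b)) (coef f) (amp^~ f)).
Proof.
move=> ib ff nf; have [lD rD] := qpair_D_front ff nf.
have eA k := esym (amp_out b k).
case: b ib eA => [/(_ isT) iv|_] eA; last first.
  split=> side.
    exact: (eq_qpair (frefl _) (frefl _) (frefl _) eA (lD side)).
  exact: (eq_qpair (frefl _) eA (frefl _) (frefl _) (rD side)).
have sk k : (x v)^-1 * amp k f = t k *: (amp k f * (x v)^-1).
  rewrite -[t k in RHS]invrK; apply: (skew_inv (x_unit iv)).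
    by rewrite invr_eq0.
  exact: skew_front.
split=> side.
  apply: (eq_qpair (frefl _) (frefl _) (frefl _) eA).
  apply: (qpairMr (s := t)) => //; apply: eq_qpair (lD side) => // k.
  exact: esym (mulVf (t_neq0 k)).
apply: (eq_qpair (frefl _) eA (frefl _) (frefl _)).
apply: (qpairMl (s := t)) => //; apply: eq_qpair (rD side) => // k.
exact: esym (mulVf (t_neq0 k)).
Qed.

Lemma front_rel_step : front_rel i l (v |: D).
Proof.
have inn f : front (v |: D) f -> f.1 = v -> f.2 -> inner v.
  case: f => u b /andP[_ /= +] uv.
  rewrite uv => + bT; rewrite bT => /existsP[z].
  by case/andP=> /HedgeP[/edge_ends[_ nsk _ _] _ _] _; apply: innerV.
split=> [f ff|f g ff fg fg_before].
  have [/andP[ofD _]|/(front_next ff) fv] := boolP (front D f && ~~ into f v).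
    exact: relD.1.
  case: f ff fv => u b ff /= uv; rewrite uv in ff *.
  exact/qcol_new/(inn _ ff).
have [/andP[fD nf]|/(front_next ff) fv] := boolP (front D f && ~~ into f v);
have [/andP[gD ng]|/(front_next fg) gv] := boolP (front D g && ~~ into g v).
- exact: relD.2.
- case: g fg gv fg_before => u b fg /= uv; rewrite uv in fg *.
  move/(before_left fD nf); exact: (qpair_new_front (inn _ fg erefl) fD nf).1.
- case: f ff fv fg_before => u b ff /= uv; rewrite uv in ff *.
  move/(before_right gD ng); exact: (qpair_new_front (inn _ ff erefl) gD ng).2.
case: f ff fv fg_before => u b ff /= uv; rewrite uv in ff *.
case: g fg gv => w b' fg /= wv; rewrite wv in fg *.
(* Of the two strands leaving [v], the downward one comes first; this is the only case left. *)
rewrite /before /=; case: b b' ff fg => [] [] ff fg; rewrite ?ltxx //.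
move=> _; have iv := inn _ fg erefl isT.
have pDE := qpair_out q_neq0 (x_unit iv) t_neq0 (fun k => skew_D k iv) qcol_D.
by apply: eq_qpair pDE => // k; rewrite amp_out.
Qed.

End Step.

(** * The initial front and induction along the sweep *)

Lemma front_rel_sources (i l : 'I_m) (D : {set V}) : (i < l)%N ->
  (forall u, u \in D -> source u) -> front_rel i l D.
Proof.
move=> il srcD.
have frontE f : front D f -> exists a, f = (r a, true).
  case: f => u b /andP[/= /srcD su]; have [a uE] := sourceP _ su.
  case: b => [|/orP[sku|/existsP[z /andP[Vuz _]]]].
  - by exists a; rewrite uE.
  - by have := sourceNsink su; rewrite sku.
  - by have := Vedge_source Vuz; rewrite su.
have ampE k a : amp k (r a, true) = (k == a)%:R.
  by rewrite /amp /= source_r mulr1 path_sum_source.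
have il_neq : i != l by rewrite -val_eqE /= ltn_eqF.
split=> [f /frontE[a ->]|f g /frontE[a ->] /frontE[b ->]].
  rewrite /qcol !ampE; have [ia|] := eqVneq i a; last first.
    by rewrite !(mul0r, mulr0) !scaler0.
  by rewrite -ia eq_sym (negPf il_neq) !(mul0r, mulr0) !scaler0.
rewrite /before /= => ab; have lt_ab : (a < b)%N.
  case: (ltngtP a b) => // [/source_py|/val_inj e]; first by rewrite ltNge ltW.
  by rewrite e ltxx in ab.
have ab_neq : a != b by rewrite -val_eqE /= ltn_eqF.
(* The columns are unit vectors and [a < b], so a product survives only for [k = a] and [k' = b]. *)
have prod0 (k k' : 'I_m) :
    (k == k') || (k' < k)%N -> (k == a)%:R * (k' == b)%:R = 0 :> A.
  move=> kk'; case: eqP => [ka|_]; last by rewrite mul0r.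
  case: eqP => [kb|_]; last by rewrite mulr0.
  by move: kk'; rewrite ka kb (negPf ab_neq) /= ltnNge ltnW.
have prod0' (k k' : 'I_m) :
    (k == k') || (k' < k)%N -> (k' == b)%:R * (k == a)%:R = 0 :> A.
  move=> kk'; case: eqP => [kb|_]; last by rewrite mul0r.
  case: eqP => [ka|_]; last by rewrite mulr0.
  by move: kk'; rewrite ka kb (negPf ab_neq) /= ltnNge ltnW.
rewrite /qpair !ampE prod0 ?eqxx // prod0' ?eqxx // prod0 ?il ?orbT //.
rewrite prod0' ?il ?orbT // !scaler0; split=> //.
(* For [i = a] and [l = b] both coefficients are 1, since no horizontal path joins distinct sources,
   and the two products cancel. *)
have [ia|] := eqVneq i a; last by rewrite !(mul0r, mulr0) !scaler0 subrr.
have [lb|] := eqVneq l b; last by rewrite !(mul0r, mulr0) !scaler0 subrr.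
rewrite mulr1 /coef /= -ia -lb.
have Hrr k k' : k != k' -> Hpath (r k) (r k') = false.
  move=> kk'; apply/negP => /Hpath_py e; move: kk'; rewrite -val_eqE /=.
  by case: ltngtP => // /source_py; rewrite e ltxx.
by rewrite !Hrr // 1?eq_sym // subrr.
Qed.

(** All sources count as swept from the start: a low source may have larger [sweep] than inner
    vertices on higher rows. *)
Definition swept (D : {set V}) : Prop :=
  (forall u, source u -> u \in D) /\
  (forall u z, u \in D -> ~~ source u -> z \notin D -> sweep u <= sweep z).

Lemma front_rel_swept (i l : 'I_m) (D : {set V}) : (i < l)%N ->
  swept D -> front_rel i l D.
Proof.
move=> il; have [N] := ubnP #|D|; elim: N D => // N IHN D leN [srcD sD].
case: (pickP [pred u | (u \in D) && ~~ source u]) => [u0 u0P|D0]; last first.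
  apply: front_rel_sources => // u uD.
  by have := D0 u; rewrite /= uD => /negbFE.
(* A non-source of largest [sweep] in [D] can be taken as the last one swept; without it [D] is
   still swept. *)
case: (Order.TotalTheory.arg_maxP sweep u0P) => v /andP[vD sv] vmax.
have vD0 : v \notin D :\ v by rewrite !inE eqxx.
have past u : u \in D :\ v -> ~~ source u -> sweep u <= sweep v.
  by rewrite !inE => /andP[_ uD] su; apply: vmax; rewrite /= uD.
have future z : z \notin D :\ v -> sweep v <= sweep z.
  rewrite !inE negb_and negbK => /orP[/eqP -> //|zD]; exact: sD.
rewrite -(setD1K vD); apply: front_rel_step => //; apply: IHN.
  by rewrite (cardsD1 v D) vD in leN.
split=> [u su|u z uD su /future]; last exact/le_trans/past.
by rewrite !inE srcD // andbT; apply: contraNneq sv => <-.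
Qed.

Lemma path_matrixE i j : path_matrix px py E r c x i j = amp i (c j, false).
Proof. by rewrite mxE /amp mulr1. Qed.

End SEGraph.

Theorem theorem3p2
  (R : realFieldType) (V : finType) (px py : V -> R) (E : rel V)
  (m n : nat) (r : 'I_m -> V) (c : 'I_n -> V)
  (K : fieldType) (q : K) (A : unitAlgType K) (x : V -> A) :
  q != 0 ->
  SE_graph px py E r c ->
  LG_rel px py E r c q x ->
  let p := path_matrix px py E r c x in
  forall (i l : 'I_m) (j k : 'I_n), (i < l)%N -> (j < k)%N ->
  [/\ p i j * p i k = q *: (p i k * p i j),
      p i j * p l j = q *: (p l j * p i j),
      p i k * p l j = p l j * p i k
    & p i j * p l k - p l k * p i j = (q - q^-1) *: (p i k * p l j)].
Proof.
move=> q0 HG HL p i l j k il jk.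
(* Once everything is swept, the front consists of the downward strands of the sinks, where [coef]
   is 1. *)
have swT : swept px py r [set: V] by split=> [u|u z]; rewrite !inE.
have [col pair] := front_rel_swept HG q0 HL il swT.
have fr j' : front px py E c [set: V] (c j', false).
  by rewrite /front /= inE sink_c.
have bjk : before px py (c j, false) (c k, false) by exact: (sink_px HG jk).
have := col _ (fr j); have [] := pair _ _ (fr j) (fr k) bjk.
rewrite /qcol /coef /= !mulr1 !scale1r.
by split; rewrite /p !path_matrixE.
Qed.
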